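(* Let $A\subseteq\mathbb N^{\mathbb N}$ and let $f$ be a problem. \begin{enumerate} \item If $f\le_{\mathrm W}\mathsf C_A$, then $f^\infty\le_{\mathrm W}\mathsf C_{A^{\mathbb N}}$. \item If $f\le_{\mathrm W}\mathsf{UC}_A$, then $f^\infty\le_{\mathrm W}\mathsf{UC}_{A^{\mathbb N}}$. \end{enumerate}
   Context: Problems. A represented space $(X,\delta_X)$ is a set $X$ with a surjective partial map $\delta_X:\subseteq\mathbb N^{\mathbb N}\to X$. A partial function $F:\subseteq\mathbb N^{\mathbb N}\to\mathbb N^{\mathbb N}$ is computable if there is a computable monotone (w.r.t. the prefix order) word function $\varphi:\mathbb N^*\to\mathbb N^*$ with $F(p)=\sup_{w\sqsubseteq p}\varphi(w)$ for all $p\in\mathrm{dom}(F)$. For a partial multivalued function $f:\subseteq X\rightrightarrows Y$ between represented spaces, $F:\subseteq\mathbb N^{\mathbb N}\to\mathbb N^{\mathbb N}$ is a realizer of $f$, written $F\vdash f$, if $\delta_YF(p)\in f\delta_X(p)$ for all $p\in\mathrm{dom}(f\delta_X)$. A problem is a multivalued function with a realizer. Composition: $g\circ f(x)=\{z:(\exists y\in f(x))\,z\in g(y)\}$ with $\mathrm{dom}(g\circ f)=\{x\in\mathrm{dom}(f):f(x)\subseteq\mathrm{dom}(g)\}$. The realizer version of $f$ is $f^{\mathrm r}:=\delta_Y^{-1}\circ f\circ\delta_X:\subseteq\mathbb N^{\mathbb N}\rightrightarrows\mathbb N^{\mathbb N}$. Tupling. $\langle q,p\rangle:=q(0)p(0)q(1)p(1)\dots$,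 and $\langle p_0,p_1,p_2,\dots\rangle$ is the standard countable tupling, e.g. $\langle p_0,p_1,\dots\rangle(\langle i,j\rangle)=p_i(j)$. $\langle\mathrm{id}\times f\rangle$ is the problem $\langle q,p\rangle\mapsto\{\langle q,r\rangle:r\in f(p)\}$. Universal function. $\Phi$ is a fixed standard total representation of a set of continuous partial functions on $\mathbb N^{\mathbb N}$ (with natural domains), where a name $q$ encodes the graph of a monotone word function approximating $\Phi_q$; $\mathsf U_q:=\Phi_q$, and $\mathsf U\langle q,p\rangle:=\mathsf U_q(p)$ is a computable partial function. The smn-theorem holds: for every computable (continuous) $F:\subseteq\mathbb N^{\mathbb N}\to\mathbb N^{\mathbb N}$ there is a total computable (continuous) $S$ with $\mathsf U_{S(q)}(p)=F\langle q,p\rangle$ for all $\langle q,p\rangle\in\mathrm{dom}(F)$. Infinite loop. For a problem $f:\subseteq\mathbb N^{\mathbb N}\rightrightarrows\mathbb N^{\mathbb N}$, $f^\infty(q_0):=\{\langle q_0,q_1,q_2,\dots\rangle:(\forall i)\ q_{i+1}\in\mathsf U\circ\langle\mathrm{id}\times f\rangle(q_i)\}$, with $\mathrm{dom}(f^\infty)$ the set of all $q_0$ such that $A_0:=\{q_0\}\subseteq\mathrm{dom}(\mathsf U\circ\langle\mathrm{id}\times f\rangle)$ and $A_{i+1}:=\mathsf U\circ\langle\mathrm{id}\times f\rangle(A_i)\subseteq\mathrm{dom}(\mathsf U\circ\langle\mathrm{id}\times f\rangle)$ for all $i$. For arbitrary $f$, $f^\infty:=(f^{\mathrm r})^\infty$.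 Weihrauch reducibility. $f\le_{\mathrm W}g$ if there are computable $H,K:\subseteq\mathbb N^{\mathbb N}\to\mathbb N^{\mathbb N}$ with $H\langle\mathrm{id},GK\rangle\vdash f$ whenever $G\vdash g$. Choice. For $A\subseteq\mathbb N^{\mathbb N}$ (with the subspace representation and topology), $\mathcal A_-(A)$ is the space of relatively closed subsets $B$ of $A$ given by negative information: a name of $B$ is an enumeration of (codes of) words $w_0,w_1,\dots$ (possibly none) with $A\setminus B=A\cap\bigcup_i w_i\mathbb N^{\mathbb N}$. $\mathsf C_A:\subseteq\mathcal A_-(A)\rightrightarrows A$, $B\mapsto B$, has as domain the nonempty closed sets, and $\mathsf{UC}_A$ is its restriction to singletons. $A^{\mathbb N}$ is identified with $\{\langle r_0,r_1,r_2,\dots\rangle:(\forall i)\ r_i\in A\}\subseteq\mathbb N^{\mathbb N}$. *)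

(* Defs.v *)
From Stdlib Require Cantor.
From mathcomp Require Import all_boot boolp classical_sets topology.

Set Implicit Arguments.
Unset Strict Implicit.
Unset Printing Implicit Defensive.

Local Open Scope classical_set_scope.

(* Total computable functions, as Kleene's class of general recursive functions:
   minimization is only applied to predicates that have a zero for every
   argument, so no partial functions are needed. *)
Inductive recursive : forall n, (n.-tuple nat -> nat) -> Prop :=
| rec_zero n : recursive (fun _ : n.-tuple nat => 0)
| rec_succ : recursive (fun x : 1.-tuple nat => (thead x).+1)
| rec_proj n (i : 'I_n) : recursive (fun x : n.-tuple nat => tnth x i)
| rec_comp m n (g : m.-tuple nat -> nat) (h : 'I_m -> n.-tuple nat -> nat) :
    recursive g -> (forall i, recursive (h i)) ->
    recursive (fun x : n.-tuple nat => g [tuple h i x | i < m])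
| rec_primrec n (g : n.-tuple nat -> nat) (h : n.+2.-tuple nat -> nat) :
    recursive g -> recursive h ->
    recursive (fun x : n.+1.-tuple nat =>
      iteri (thead x) (fun k acc => h (cons_tuple k (cons_tuple acc (behead_tuple x))))
            (g (behead_tuple x)))
| rec_min n (g : n.+1.-tuple nat -> nat) (f : n.-tuple nat -> nat) :
    recursive g ->
    (forall x, g (cons_tuple (f x) x) = 0 /\
               forall k, k < f x -> g (cons_tuple k x) <> 0) ->
    recursive f.

Definition computable_nat (f : nat -> nat) : Prop :=
  recursive (fun x : 1.-tuple nat => f (thead x)).

Definition word := seq nat.

Definition computable_word (phi : word -> word) : Prop :=
  computable_nat (fun n => CodeSeq.code (phi (CodeSeq.decode n))).

Definition monotone_word (phi : word -> word) : Prop :=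
  forall u v, prefix u v -> prefix (phi u) (phi v).

Definition baire : Type := nat -> nat.

Definition cylinder (w : word) : set baire :=
  [set p | mkseq p (size w) = w].

(* The value [r] of sup_(w initial segment of p) phi(w), when this supremum
   exists and is an infinite sequence. *)
Definition is_sup (phi : word -> word) (p r : baire) : Prop :=
  (forall w, cylinder w p -> cylinder (phi w) r) /\
  (forall k, exists2 w, cylinder w p & k <= size (phi w)).

Lemma is_sup_unique phi p r s : is_sup phi p r -> is_sup phi p s -> r = s.
Proof.
move=> [rP unb] [sP _]; apply/funext => k.
have [w wp ltk] := unb k.+1.
have := sP w wp; rewrite -[X in _ = X -> _](rP w wp).
by move/(congr1 (fun t => nth 0 t k)); rewrite !nth_mkseq.
Qed.

Definition tuple2 (q p : baire) : baire :=
  fun n => if odd n then p n./2 else q n./2.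

Lemma tuple2_inj q p q' p' : tuple2 q p = tuple2 q' p' -> q = q' /\ p = p'.
Proof.
move=> e; split; apply/funext => n.
  by have := congr1 (fun t : baire => t n.*2) e;
    rewrite /tuple2 odd_double doubleK.
by have := congr1 (fun t : baire => t n.*2.+1) e;
  rewrite /tuple2 /= odd_double /= uphalf_double.
Qed.

Definition tupleN (ps : nat -> baire) : baire :=
  fun n => let (i, j) := Cantor.of_nat n in ps i j.

Record pmap (X Y : Type) := Pmap {
  graph :> X -> Y -> Prop;
  graph_functional : forall x y z, graph x y -> graph x z -> y = z }.

(* Multivalued functions; [mval f x] is meaningful for [x] in [mdom f] only. *)
Record mfun (X Y : Type) := Mfun {
  mdom : set X;
  mval :> X -> set Y }.

Definition mfun_of_pmap X Y (F : pmap X Y) : mfun X Y :=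
  Mfun [set x | exists y, F x y] (fun x => [set y | F x y]).
Coercion mfun_of_pmap : pmap >-> mfun.

Definition minv X Y (F : pmap X Y) : mfun Y X :=
  Mfun [set y | exists x, F x y] (fun y => [set x | F x y]).

Definition mcomp X Y Z (g : mfun Y Z) (f : mfun X Y) : mfun X Z :=
  Mfun [set x | mdom f x /\ mval f x `<=` mdom g]
       (fun x => [set z | exists2 y, mval f x y & mval g y z]).

Definition mimage X Y (f : mfun X Y) (D : set X) : set Y :=
  \bigcup_(x in D) mval f x.

Lemma pcomp_subproof X Y Z (G : pmap Y Z) (F : pmap X Y) x z z' :
  (exists2 y, F x y & G y z) -> (exists2 y, F x y & G y z') -> z = z'.
Proof.
move=> [y Fy Gz] [y' Fy' Gz'].
rewrite (graph_functional Fy' Fy) in Gz'.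
exact: graph_functional Gz Gz'.
Qed.

Definition pcomp X Y Z (G : pmap Y Z) (F : pmap X Y) : pmap X Z :=
  Pmap (@pcomp_subproof _ _ _ G F).

Definition pid X : pmap X X :=
  Pmap (fun (x y z : X) (xy : x = y) (xz : x = z) => eq_trans (esym xy) xz).

Lemma ptuple2_subproof X (F G : pmap X baire) x r r' :
  (exists q p, [/\ F x q, G x p & r = tuple2 q p]) ->
  (exists q p, [/\ F x q, G x p & r' = tuple2 q p]) -> r = r'.
Proof.
move=> [q [p [Fq Gp ->]]] [q' [p' [Fq' Gp' ->]]].
by rewrite (graph_functional Fq Fq') (graph_functional Gp Gp').
Qed.

Definition ptuple2 X (F G : pmap X baire) : pmap X baire :=
  Pmap (@ptuple2_subproof X F G).

Definition computable (F : pmap baire baire) : Prop :=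
  exists phi : word -> word,
    [/\ computable_word phi, monotone_word phi
      & forall p r, F p r -> is_sup phi p r].

Record repspace := Repspace {
  carrier :> Type;
  delta : pmap baire carrier;
  delta_surj : forall x, exists p, delta p x }.

Definition realizes (X Y : repspace) (F : pmap baire baire) (f : mfun X Y) :
    Prop :=
  forall p, mdom (mcomp f (delta X)) p ->
    exists r y, [/\ F p r, delta Y r y & mval (mcomp f (delta X)) p y].

Definition problem (X Y : repspace) (f : mfun X Y) : Prop :=
  exists F, realizes F f.

Definition realizer_version (X Y : repspace) (f : mfun X Y) :
    mfun baire baire :=
  mcomp (minv (delta Y)) (mcomp f (delta X)).

Definition weihrauch (X Y Z W : repspace) (f : mfun X Y) (g : mfun Z W) :
    Prop :=
  exists H K : pmap baire baire,
    [/\ computable H, computable K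
      & forall G : pmap baire baire, realizes G g ->
          realizes (pcomp H (ptuple2 (pid baire) (pcomp G K))) f].

(* The name [q] encodes the word function w |-> phi(w) by the values
   q(code w) = code(phi(w)).  Every [q] names a partial function, whose domain
   consists of all [p] along which the supremum is an infinite sequence; when
   the encoded word function is not monotone, this includes the requirement
   that its values along [p] are all initial segments of one sequence. *)
Definition word_function_of (q : baire) : word -> word :=
  fun w => CodeSeq.decode (q (CodeSeq.code w)).

Definition Phi (q : baire) : pmap baire baire :=
  Pmap (@is_sup_unique (word_function_of q)).

Lemma U_subproof (x r r' : baire) :
  (exists q p, x = tuple2 q p /\ Phi q p r) ->
  (exists q p, x = tuple2 q p /\ Phi q p r') -> r = r'.
Proof.
move=> [q [p [-> Pr]]] [q' [p' [/tuple2_inj [<- <-] Pr']]].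
exact: graph_functional Pr Pr'.
Qed.

Definition U : pmap baire baire := Pmap U_subproof.

Definition id_times (f : mfun baire baire) : mfun baire baire :=
  Mfun [set x | exists q p, x = tuple2 q p /\ mdom f p]
       (fun x => [set y | exists q p r,
          [/\ x = tuple2 q p, mval f p r & y = tuple2 q r]]).

Definition loop_step (f : mfun baire baire) : mfun baire baire :=
  mcomp U (id_times f).

Definition loop (f : mfun baire baire) : mfun baire baire :=
  Mfun [set q0 | forall i,
          iter i (mimage (loop_step f)) [set q0] `<=` mdom (loop_step f)]
       (fun q0 => [set t | exists q : nat -> baire,
          [/\ q 0 = q0, forall i, mval (loop_step f) (q i) (q i.+1)
            & t = tupleN q]]).

Lemma baire_space_subproof (x : baire) : exists p, pid baire p x.
Proof. by exists x. Qed.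

Definition baire_space : repspace := Repspace baire_space_subproof.

Definition infinite_loop (X Y : repspace) (f : mfun X Y) :
    mfun baire_space baire_space :=
  loop (realizer_version f).

Section ClosedChoice.
Variable A : set baire.

Lemma subspace_functional (p : baire) (x y : A) :
  p = val x -> p = val y -> x = y.
Proof. by move=> px py; apply: val_inj; rewrite -px. Qed.

Lemma subspace_surj (x : A) : exists p, Pmap subspace_functional p x.
Proof. by exists (val x). Qed.

Definition subspace_rep : repspace := Repspace subspace_surj.

Definition relatively_closed : set (set baire) :=
  [set B | exists2 C : set {ptws nat -> nat}, closed C & B = A `&` C].

(* The value 0 lists no word, so that the empty enumeration also has names. *)
Definition listed (p : baire) : set word :=
  [set w | exists n, p n = (CodeSeq.code w).+1].

Definition negative_name (p : baire) (B : relatively_closed) : Prop :=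
  A `\` val B = A `&` \bigcup_(w in listed p) cylinder w.

Lemma negative_functional p B B' :
  negative_name p B -> negative_name p B' -> B = B'.
Proof.
rewrite /negative_name => pB pB'; apply: val_inj.
have sub (D : relatively_closed) : val D = A `\` (A `\` val D).
  have [C _ ->] := set_valP D.
  by rewrite setDIr setDv set0U setDD; apply/seteqP; split => x /=; tauto.
by rewrite (sub B) (sub B') pB pB'.
Qed.

Lemma cylinder_nbhs (p : baire) (V : set {ptws nat -> nat}) :
  open V -> V p -> exists n, cylinder (mkseq p n) `<=` V.
Proof.
move=> oV Vp; apply: contrapT => /forallNP nsub.
have /boolp.choice [s sP] n : exists s, cylinder (mkseq p n) s /\ ~ V s.
  by have /nonsubset [s [cs ns]] := nsub n; exists s.
have scvg : (s : nat -> {ptws nat -> nat}) @ \oo --> (p : {ptws nat -> nat}).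
  apply/cvg_sup => i W [Z] [[O oO <-] Op ZW].
  apply: (filterS ZW); rewrite nbhs_simpl; exists i.+1 => // n /= lt_in.
  have [+ _] := sP n; rewrite /cylinder /= size_mkseq.
  by move/(congr1 (fun t => nth 0 t i)); rewrite !nth_mkseq // => ->.
have [N _ /(_ N (leqnn N))] := scvg V (open_nbhs_nbhs (conj oV Vp)).
by case: (sP N).
Qed.

Lemma negative_surj B : exists p, Pmap negative_functional p B.
Proof.
have [C Cc BE] := set_valP B.
exists (fun n => if `[< C `&` cylinder (CodeSeq.decode n) = set0 >]
                 then n.+1 else 0).
rewrite /= /negative_name BE; apply/seteqP; split => r /=.
  move=> [Ar nCr]; split => //.
  have [|n sub] := @cylinder_nbhs r (~` C) (closed_openC Cc).
    by move=> Cr; apply: nCr.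
  exists (mkseq r n); last by rewrite /cylinder /= size_mkseq.
  exists (CodeSeq.code (mkseq r n)); rewrite CodeSeq.codeK.
  by case: asboolP => // -[]; apply/seteqP; split => // s [Cs /sub].
move=> [Ar [w [n]]]; case: asboolP => // dis [nw] wr; split => // -[_ Cr].
by rewrite -[False]/(set0 r) -dis nw CodeSeq.codeK.
Qed.

Definition closed_subsets : repspace := Repspace negative_surj.

Definition closed_choice : mfun closed_subsets subspace_rep :=
  Mfun [set B : relatively_closed | val B !=set0]
       (fun B : relatively_closed => [set x : A | val B (val x)]).

Definition unique_choice : mfun closed_subsets subspace_rep :=
  Mfun [set B : relatively_closed | exists r, val B = [set r]] (mval closed_choice).

End ClosedChoice.

Definition sequences_in (A : set baire) : set baire :=
  [set t | exists rs : nat -> baire, (forall i, A (rs i)) /\ t = tupleN rs].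

(* Main.v *)
(* Let [x_0, x_1, ...] be the run of the loop from [x_0], where [x_i] encodes a
   pair of a name [q_i] and an instance [p_i] of [f].  A reduction of [f] to
   choice on [A] turns each [p_i] into a closed set [B_i] and each point [a_i] of
   [B_i], together with [p_i], into a solution of [f] at [p_i], hence into
   [x_(i+1)].  So [x_i] is computable from [x_0] and [a_0, ..., a_(i-1)], and the
   set of the sequences [<a_0, a_1, ...>] with [a_i] in [B_i] for all [i] is
   closed with negative information computable from [x_0]: a word [w] is excluded
   as soon as, for some [i], the approximation of [B_i] computed from [x_0] and
   [w] lists an initial segment of the [i]-th component of [w].  If an earlier
   component has already left its set, this approximation is meaningless, but
   then the sequence has to be excluded anyway.  If all the [B_i] are singletons,
   so is the set of sequences. *)

From Stdlib Require Cantor.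
Require Import Defs.
From mathcomp Require Import all_boot classical_sets.
From mathcomp Require Import boolp topology zify.

Set Implicit Arguments.
Unset Strict Implicit.
Unset Printing Implicit Defensive.

(** * Recursive functions *)

Lemma recursive_thead n : recursive (fun x : n.+1.-tuple nat => thead x).
Proof. exact: rec_proj. Qed.

Lemma recursive_behead n (f : n.-tuple nat -> nat) :
  recursive f -> recursive (fun x : n.+1.-tuple nat => f (behead_tuple x)).
Proof.
move=> recf.
suff -> : (fun x : n.+1.-tuple nat => f (behead_tuple x)) =
          (fun x => f [tuple tnth x (lift ord0 i) | i < n]).
  exact: (rec_comp recf (fun i => rec_proj (lift ord0 i))).
apply/funext => x; congr f; apply: eq_from_tnth => i.
rewrite tnth_mktuple tnth_behead; congr (tnth x _).
by apply: val_inj; rewrite /= inordK // ltnS.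
Qed.

Lemma recursive_thead2 n :
  recursive (fun x : n.+2.-tuple nat => thead (behead_tuple x)).
Proof. exact: (recursive_behead (recursive_thead n)). Qed.

Lemma recursive_thead3 n :
  recursive (fun x : n.+3.-tuple nat => thead (behead_tuple (behead_tuple x))).
Proof. exact: (recursive_behead (recursive_thead2 n)). Qed.

(** Primitive recursion takes its bound from the first argument. Substituting [m x] there and [x]
    for the parameters ([arg]) lets bound, start and step all depend on [x]. *)
Lemma recursive_iteri n (m z : n.-tuple nat -> nat)
    (h : n.-tuple nat -> nat -> nat -> nat) :
    recursive m -> recursive z ->
    recursive (fun x : n.+2.-tuple nat =>
      h (behead_tuple (behead_tuple x)) (thead x) (thead (behead_tuple x))) ->
  recursive (fun x => iteri (m x) (h x) (z x)).
Proof.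
move=> recm recz /(rec_primrec recz) recit.
pose arg (i : 'I_n.+1) (x : n.-tuple nat) :=
  if unlift ord0 i is Some j then tnth x j else m x.
have recarg i : recursive (arg i).
  by rewrite /arg; case: unliftP => [j|] _ //; apply: rec_proj.
have := rec_comp recit recarg; congr recursive; apply/funext => x.
have -> : behead_tuple [tuple arg i x | i < n.+1] = x.
  apply: eq_from_tnth => i; rewrite tnth_behead tnth_mktuple /arg.
  rewrite (_ : inord i.+1 = lift ord0 i) ?liftK //.
  by apply: val_inj; rewrite /= inordK // ltnS.
have -> : thead [tuple arg i x | i < n.+1] = m x.
  by rewrite /thead tnth_mktuple /arg unlift_none.
apply: eq_iteri => k acc; congr (h _ _ _).
by apply: eq_from_tnth => i; rewrite !tnth_behead !(tnth_nth 0) /= !inordK ?ltnS.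
Qed.

Lemma recursive_comp1 n (g : nat -> nat) (f : n.-tuple nat -> nat) :
  computable_nat g -> recursive f -> recursive (fun x => g (f x)).
Proof.
move=> recg recf.
have := rec_comp (h := fun=> f) recg (fun=> recf); congr recursive.
by apply/funext => x; rewrite /thead tnth_mktuple.
Qed.

Definition computable_nat2 (g : nat -> nat -> nat) : Prop :=
  recursive (fun x : 2.-tuple nat => g (thead x) (thead (behead_tuple x))).

Lemma recursive_comp2 n (g : nat -> nat -> nat) (f1 f2 : n.-tuple nat -> nat) :
  computable_nat2 g -> recursive f1 -> recursive f2 ->
  recursive (fun x => g (f1 x) (f2 x)).
Proof.
move=> recg rec1 rec2.
pose arg (i : 'I_2) := if i == ord0 then f1 else f2.
have recarg i : recursive (arg i) by rewrite /arg; case: ifP.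
have := rec_comp recg recarg; congr recursive.
apply/funext => x; rewrite /thead tnth_behead !tnth_mktuple /arg /=.
by congr (g _ (_ x)); case: eqP => // /(congr1 val); rewrite /= inordK.
Qed.

Lemma recursive_const n c : recursive (fun _ : n.-tuple nat => c).
Proof.
by elim: c => [|c IHc]; [exact: rec_zero | exact: (recursive_comp1 rec_succ IHc)].
Qed.

Ltac recursive_tac :=
  first [ exact: recursive_thead | exact: recursive_thead2
        | exact: recursive_thead3 | exact: recursive_const ].

Lemma computable_pred : computable_nat predn.
Proof.
have : computable_nat (fun n => iteri n (fun k _ => k) 0).
  by apply: recursive_iteri; recursive_tac.
by congr recursive; apply/funext => x; case: (thead x).
Qed.

Lemma computable_addn : computable_nat2 addn.
Proof.
have : computable_nat2 (fun m n => iteri m (fun _ acc => acc.+1) n).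
  apply: recursive_iteri; try recursive_tac.
  by apply: (recursive_comp1 rec_succ); recursive_tac.
congr recursive; apply/funext => x.
by elim: (thead x) => //= m ->.
Qed.

Lemma computable_subn : computable_nat2 subn.
Proof.
have : computable_nat2 (fun m n => iteri n (fun _ acc => acc.-1) m).
  apply: recursive_iteri; try recursive_tac.
  by apply: (recursive_comp1 computable_pred); recursive_tac.
congr recursive; apply/funext => x.
by elim: (thead (behead_tuple x)) => [|n /= ->]; rewrite ?subn0 ?subnS.
Qed.

Lemma computable_half : computable_nat half.
Proof.
(* The recursion is [n.+1./2 = n - n./2]. *)
have : computable_nat (fun n => iteri n (fun k acc => k - acc) 0).
  apply: recursive_iteri; try recursive_tac.
  by apply: (recursive_comp2 computable_subn); recursive_tac.
congr recursive; apply/funext => x.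
elim: (thead x) => //= n ->.
by rewrite uphalf_half -{1}(odd_double_half n) -addnn addnA addnK.
Qed.

Lemma computable_odd : computable_nat odd.
Proof.
have : computable_nat (fun n => iteri n (fun _ acc => 1 - acc) 0).
  apply: recursive_iteri; try recursive_tac.
  by apply: (recursive_comp2 computable_subn); recursive_tac.
congr recursive; apply/funext => x.
by elim: (thead x) => //= n ->; case: odd.
Qed.

(* Chosen so that [CodeSeq.code (a :: w) = (pair_nat a (CodeSeq.code w)).+1]. *)
Definition pair_nat (a b : nat) := (2 ^ a * b.*2.+1).-1.

Lemma pair_natS a b : (pair_nat a b).+1 = 2 ^ a * b.*2.+1.
Proof. by rewrite /pair_nat prednK // muln_gt0 expn_gt0. Qed.

Lemma computable_pair_nat : computable_nat2 pair_nat.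
Proof.
have : computable_nat2
    (fun a b => (iteri a (fun _ acc => acc + acc) (b + b).+1).-1).
  apply: (recursive_comp1 computable_pred).
  apply: recursive_iteri; [by recursive_tac | |].
    apply: (recursive_comp1 rec_succ).
    by apply: (recursive_comp2 computable_addn); recursive_tac.
  by apply: (recursive_comp2 computable_addn); recursive_tac.
congr recursive; apply/funext => x; rewrite /pair_nat addnn.
congr predn; elim: (thead x) => [|a /= ->]; rewrite ?mul1n //.
by rewrite addnn -mul2n mulnA -expnS.
Qed.

Lemma iter_half_exp a b : iter a half (2 ^ a * b) = b.
Proof.
elim: a => [|a IHa]; first by rewrite mul1n.
by rewrite iterSr expnS -mulnA mul2n doubleK.
Qed.

(** Only the empty word has code 0, so [c.+1] codes a nonempty word, whose head and tail are the two
    components of [c]. *)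
Definition unpair1 (c : nat) := head 0 (CodeSeq.decode c.+1).
Definition unpair2 (c : nat) := CodeSeq.code (behead (CodeSeq.decode c.+1)).

Lemma code_cons a w : CodeSeq.code (a :: w) = (pair_nat a (CodeSeq.code w)).+1.
Proof. by rewrite pair_natS. Qed.

Lemma pair_natK1 a b : unpair1 (pair_nat a b) = a.
Proof.
by rewrite /unpair1 -[b]CodeSeq.decodeK -code_cons CodeSeq.codeK.
Qed.

Lemma pair_natK2 a b : unpair2 (pair_nat a b) = b.
Proof.
by rewrite /unpair2 -[b]CodeSeq.decodeK -code_cons CodeSeq.codeK.
Qed.

Lemma unpairK c : pair_nat (unpair1 c) (unpair2 c) = c.
Proof.
apply: succn_inj; rewrite -[RHS]CodeSeq.decodeK /unpair1 /unpair2.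
case: (CodeSeq.decode c.+1) (CodeSeq.decodeK c.+1) => [//|a w] _.
by rewrite code_cons.
Qed.

Lemma iter_half_unpair c k :
  k <= unpair1 c ->
  iter k half c.+1 = 2 ^ (unpair1 c - k) * (unpair2 c).*2.+1.
Proof.
move=> lek; rewrite -[in LHS](unpairK c) pair_natS -(subnKC lek) expnD -mulnA.
by rewrite iter_half_exp subnKC.
Qed.

Lemma computable_iter_half : computable_nat2 (fun k n => iter k half n).
Proof.
have : computable_nat2 (fun k n => iteri k (fun _ acc => acc./2) n).
  apply: recursive_iteri; try recursive_tac.
  by apply: (recursive_comp1 computable_half); recursive_tac.
by congr recursive; apply/funext => x; elim: (thead x) => //= k ->.
Qed.

Lemma computable_unpair1 : computable_nat unpair1.
Proof.
(* The first component is the exponent of 2 in [c.+1]: the least number of halvings after which the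
   result is odd. *)
apply: (@rec_min 1 (fun y : 2.-tuple nat =>
  1 - odd (iter (thead y) half (thead (behead_tuple y)).+1))).
  apply: (recursive_comp2 computable_subn); first by recursive_tac.
  apply: (recursive_comp1 computable_odd).
  apply: (recursive_comp2 computable_iter_half); first by recursive_tac.
  by apply: (recursive_comp1 rec_succ); recursive_tac.
move=> x; have beheadK k : behead_tuple (cons_tuple k x) = x by apply: val_inj.
split=> [|k ltk]; rewrite beheadK theadE.
  by rewrite iter_half_unpair // subnn mul1n /= odd_double.
rewrite iter_half_unpair; last exact: ltnW.
by rewrite oddM oddX /= orbF subn_eq0 leqNgt ltk.
Qed.

Lemma computable_unpair2 : computable_nat unpair2.
Proof.
have : computable_nat (fun c => (iter (unpair1 c) half c.+1)./2).
  apply: (recursive_comp1 computable_half).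
  apply: (recursive_comp2 computable_iter_half).
    exact: computable_unpair1.
  exact: rec_succ.
congr recursive; apply/funext => x.
by rewrite iter_half_unpair // subnn mul1n /= uphalf_double.
Qed.

(** * Computability on coded types *)

(** No decoding is asked for: a function is tracked by any recursive function that agrees with it on
    codes, whatever it does on other numbers. *)
Class coded (T : Type) := Coded { enc : T -> nat }.
#[local] Instance coded_nat : coded nat := Coded id.
#[local] Instance coded_bool : coded bool := Coded nat_of_bool.
#[local] Instance coded_word : coded word := Coded CodeSeq.code.
#[local] Instance coded_pair S T (cS : coded S) (cT : coded T) : coded (S * T) :=
  Coded (fun x => pair_nat (enc x.1) (enc x.2)).

Definition tracked S T {cS : coded S} {cT : coded T} (f : S -> T) : Prop :=
  exists2 g, computable_nat g & forall x, g (enc x) = enc (f x).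

Definition tracked2 S1 S2 T {cS1 : coded S1} {cS2 : coded S2} {cT : coded T}
    (f : S1 -> S2 -> T) : Prop :=
  tracked (fun x : S1 * S2 => f x.1 x.2).

Definition tracked3 S1 S2 S3 T {cS1 : coded S1} {cS2 : coded S2} {cS3 : coded S3}
    {cT : coded T} (f : S1 -> S2 -> S3 -> T) : Prop :=
  tracked (fun x : S1 * S2 * S3 => f x.1.1 x.1.2 x.2).

Section Tracked.
Context {R S T : Type} {cR : coded R} {cS : coded S} {cT : coded T}.

Lemma tracked_id : tracked (fun x : R => x).
Proof. by exists id => //; exact: recursive_thead. Qed.

Lemma tracked_const (c : S) : tracked (fun _ : R => c).
Proof. by exists (fun _ => enc c) => //; exact: recursive_const. Qed.

Lemma tracked_comp (f : S -> T) (g : R -> S) :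
  tracked f -> tracked g -> tracked (fun x => f (g x)).
Proof.
move=> [f' recf ff'] [g' recg gg']; exists (fun n => f' (g' n)).
  exact: (recursive_comp1 recf).
by move=> x; rewrite gg' ff'.
Qed.

Lemma tracked_pair (f : R -> S) (g : R -> T) :
  tracked f -> tracked g -> tracked (fun x => (f x, g x)).
Proof.
move=> [f' recf ff'] [g' recg gg']; exists (fun n => pair_nat (f' n) (g' n)).
  exact: (recursive_comp2 computable_pair_nat).
by move=> x; rewrite gg' ff'.
Qed.

Lemma tracked_fst (f : R -> S * T) : tracked f -> tracked (fun x => (f x).1).
Proof.
move=> [f' recf ff']; exists (fun n => unpair1 (f' n)).
  exact: (recursive_comp1 computable_unpair1).
by move=> x; rewrite ff' pair_natK1.
Qed.

Lemma tracked_snd (f : R -> S * T) : tracked f -> tracked (fun x => (f x).2).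
Proof.
move=> [f' recf ff']; exists (fun n => unpair2 (f' n)).
  exact: (recursive_comp1 computable_unpair2).
by move=> x; rewrite ff' pair_natK2.
Qed.

Lemma tracked_iteri (n : R -> nat) (h : R -> nat -> S -> S) (z : R -> S) :
  tracked n -> tracked z -> tracked (fun x : R * nat * S => h x.1.1 x.1.2 x.2) ->
  tracked (fun x => iteri (n x) (h x) (z x)).
Proof.
move=> [n' recn nn'] [z' recz zz'] [h' rech hh'].
exists (fun c =>
    iteri (n' c) (fun k acc => h' (pair_nat (pair_nat c k) acc)) (z' c)).
  apply: (recursive_iteri recn recz).
  apply: (recursive_comp1 rech); apply: (recursive_comp2 computable_pair_nat).
    by apply: (recursive_comp2 computable_pair_nat); recursive_tac.
  by recursive_tac.
move=> x; rewrite nn' zz'; elim: (n x) => //= k ->.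
by rewrite -(hh' (x, k, _)).
Qed.

End Tracked.

Lemma tracked_comp2 {R S1 S2 T : Type} {cR : coded R} {cS1 : coded S1}
    {cS2 : coded S2} {cT : coded T} (f : S1 -> S2 -> T)
    (g1 : R -> S1) (g2 : R -> S2) :
  tracked2 f -> tracked g1 -> tracked g2 -> tracked (fun x => f (g1 x) (g2 x)).
Proof.
move=> cf c1 c2.
exact: (tracked_comp (f := fun p => f p.1 p.2) cf (tracked_pair c1 c2)).
Qed.

Lemma tracked_comp3 {R S1 S2 S3 T : Type} {cR : coded R} {cS1 : coded S1}
    {cS2 : coded S2} {cS3 : coded S3} {cT : coded T} (f : S1 -> S2 -> S3 -> T)
    (g1 : R -> S1) (g2 : R -> S2) (g3 : R -> S3) :
  tracked3 f -> tracked g1 -> tracked g2 -> tracked g3 ->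
  tracked (fun x => f (g1 x) (g2 x) (g3 x)).
Proof.
move=> cf c1 c2 c3.
exact: (tracked_comp (f := fun p => f p.1.1 p.1.2 p.2) cf
  (tracked_pair (tracked_pair c1 c2) c3)).
Qed.

Lemma tracked_ext {S T : Type} {cS : coded S} {cT : coded T} (f g : S -> T) :
  f =1 g -> tracked f -> tracked g.
Proof. by move=> /funext ->. Qed.

Lemma tracked_nat_of_bool : tracked nat_of_bool.
Proof. exact: tracked_id. Qed.

Lemma tracked_if {R S : Type} {cR : coded R} {cS : coded S}
    (b : R -> bool) (t e : R -> S) :
  tracked b -> tracked t -> tracked e -> tracked (fun x => if b x then t x else e x).
Proof.
move=> cb ct ce.
(* A conditional is an iteration of zero or one rounds. *)
have : tracked (fun x => iteri (b x) (fun _ _ => t x) (e x)).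
  apply: tracked_iteri => //.
  exact: (tracked_comp (g := fun x => x.1.1) ct (tracked_fst (tracked_fst tracked_id))).
by apply: tracked_ext => x; case: (b x).
Qed.

Create HintDb tracked.

(** Second-order patterns extract the component functions and pass them explicitly, so that [apply]
    has no higher-order unification to solve. *)
Ltac tracked_step :=
  cbv beta zeta;
  match goal with
  | |- tracked (fun x => x) => exact: tracked_id
  | |- tracked (@fst _ _) => exact: (tracked_fst tracked_id)
  | |- tracked (@snd _ _) => exact: (tracked_snd tracked_id)
  | |- tracked _ => solve [eauto 2 with tracked nocore]
  | |- tracked (fun _ => ?c) => exact: tracked_const
  | |- tracked (fun x => fst (@?f x)) => apply: (tracked_fst (f := f))
  | |- tracked (fun x => snd (@?f x)) => apply: (tracked_snd (f := f))
  | |- tracked (fun x => (@?f x, @?g x)) => apply: (tracked_pair (f := f) (g := g))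
  | |- tracked (fun x => iteri (@?n x) (@?h x) (@?z x)) =>
      apply: (tracked_iteri (n := n) (h := h) (z := z))
  | |- tracked (fun x => ?f (@?g x)) =>
      apply: (tracked_comp (f := f) (g := g)); first solve [eauto 2 with tracked nocore]
  | |- tracked (fun x => ?f (@?g x) (@?h x)) =>
      apply: (tracked_comp2 (f := f) (g1 := g) (g2 := h));
      first solve [eauto 2 with tracked nocore]
  | |- tracked (fun x => ?f (@?g x) (@?h x) (@?k x)) =>
      apply: (tracked_comp3 (f := f) (g1 := g) (g2 := h) (g3 := k));
      first solve [eauto 2 with tracked nocore]
  | |- _ => apply: tracked_if
  end.

Ltac tracked_tac := repeat tracked_step.

(** * Tracked operations on numbers, words and pairs *)

Lemma tracked_succ : tracked succn.
Proof. by exists succn => //; exact: rec_succ. Qed.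

Lemma tracked_pred : tracked predn.
Proof. by exists predn => //; exact: computable_pred. Qed.

Lemma tracked_half : tracked half.
Proof. by exists half => //; exact: computable_half. Qed.

Lemma tracked_odd : tracked odd.
Proof. by exists odd => //; exact: computable_odd. Qed.

Lemma tracked_addn : tracked2 addn.
Proof.
exists (fun c => unpair1 c + unpair2 c).
  apply: (recursive_comp2 computable_addn); first exact: computable_unpair1.
  exact: computable_unpair2.
by move=> x; rewrite pair_natK1 pair_natK2.
Qed.

Lemma tracked_subn : tracked2 subn.
Proof.
exists (fun c => unpair1 c - unpair2 c).
  apply: (recursive_comp2 computable_subn); first exact: computable_unpair1.
  exact: computable_unpair2.
by move=> x; rewrite pair_natK1 pair_natK2.
Qed.

Lemma tracked_code : tracked CodeSeq.code.
Proof. by exists id => //; exact: recursive_thead. Qed.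

Lemma tracked_decode : tracked CodeSeq.decode.
Proof.
by exists id => [|x]; [exact: recursive_thead | rewrite /= CodeSeq.decodeK].
Qed.

Lemma tracked_head : tracked (head 0).
Proof.
exists (fun c => unpair1 c.-1).
  exact: (recursive_comp1 computable_unpair1 computable_pred).
case=> // a w; rewrite -[enc _]/(CodeSeq.code (a :: w)).
by rewrite code_cons [_.-1]/= pair_natK1.
Qed.

Lemma tracked_behead : tracked (behead : word -> word).
Proof.
exists (fun c => unpair2 c.-1).
  exact: (recursive_comp1 computable_unpair2 computable_pred).
case=> // a w; rewrite -[enc _]/(CodeSeq.code (a :: w)).
by rewrite code_cons [_.-1]/= pair_natK2.
Qed.

Lemma tracked_cons : tracked2 (cons : nat -> word -> word).
Proof.
exists succn; first exact: rec_succ.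
by move=> x; rewrite /enc /= -pair_natS.
Qed.

#[local] Hint Resolve tracked_succ tracked_pred tracked_half tracked_odd tracked_addn
  tracked_subn tracked_code tracked_decode tracked_head tracked_behead
  tracked_cons tracked_nat_of_bool : tracked.

Lemma tracked_double : tracked double.
Proof.
apply: (@tracked_ext _ _ _ _ (fun n => n + n)) => [n|]; first by rewrite addnn.
by tracked_tac.
Qed.

Lemma tracked_andb : tracked2 andb.
Proof. by rewrite /tracked2 /andb; tracked_tac. Qed.

Lemma tracked_orb : tracked2 orb.
Proof. by rewrite /tracked2 /orb; tracked_tac. Qed.

Lemma tracked_eq0 : tracked (fun n => n == 0).
Proof.
have : tracked (fun n => iteri n (fun _ _ => false) true) by tracked_tac.
by apply: tracked_ext; case.
Qed.

#[local] Hint Resolve tracked_double tracked_andb tracked_orb tracked_eq0 : tracked.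

Lemma tracked_leq : tracked2 leq.
Proof. exact: (tracked_comp tracked_eq0 tracked_subn). Qed.

#[local] Hint Resolve tracked_leq : tracked.

Lemma tracked_eqn : tracked2 (fun m n : nat => m == n).
Proof.
have : tracked2 (fun m n => (m <= n) && (n <= m)) by rewrite /tracked2; tracked_tac.
by apply: tracked_ext => x; rewrite eqn_leq.
Qed.

Lemma tracked_drop : tracked2 (drop : nat -> word -> word).
Proof.
have : tracked2 (fun n (s : word) => iteri n (fun _ acc => behead acc) s).
  by rewrite /tracked2; tracked_tac.
apply: tracked_ext => -[n s] /=; elim: n => [|n /= ->]; rewrite ?drop0 //.
by rewrite -drop1 drop_drop.
Qed.

#[local] Hint Resolve tracked_eqn tracked_drop : tracked.

Lemma tracked_nth : tracked2 (nth 0).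
Proof.
have : tracked2 (fun (s : word) i => head 0 (drop i s)).
  by rewrite /tracked2; tracked_tac.
by apply: tracked_ext => x; rewrite -nth0 nth_drop addn0.
Qed.

Lemma size_code (s : word) : size s <= CodeSeq.code s.
Proof.
elim: s => //= a s IHs; apply: (leq_ltn_trans IHs); rewrite -[X in X <= _]mul1n.
by apply: leq_mul; rewrite ?expn_gt0 // ltnS -addnn leq_addr.
Qed.

Lemma tracked_size : tracked (size : word -> nat).
Proof.
(* The code bounds the size, and [drop k s] has a positive code exactly for [k < size s]; counting
   these [k] gives the size. *)
have : tracked (fun s : word => iteri (CodeSeq.code s)
    (fun k acc => acc + (0 < CodeSeq.code (drop k s))) 0) by tracked_tac.
apply: tracked_ext => s.
suff sumE n : iteri n (fun k acc => acc + (0 < CodeSeq.code (drop k s))) 0 =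
    minn n (size s) by rewrite sumE; apply/minn_idPr; exact: size_code.
elim: n => [|n /= ->]; first by rewrite min0n.
have -> : (0 < CodeSeq.code (drop n s)) = (n < size s).
  rewrite -[RHS]subn_gt0 -size_drop; case: (drop n s) => // a w.
  by rewrite code_cons.
by case: ltnP => ? /=; lia.
Qed.

#[local] Hint Resolve tracked_nth tracked_size : tracked.

Lemma tracked_mkseq {R : Type} {cR : coded R} (n : R -> nat) (f : R -> nat -> nat) :
  tracked n -> tracked2 f -> tracked (fun x => mkseq (f x) (n x)).
Proof.
move=> cn cf.
(* The word grows by [cons], so its entries are produced from the last to the first. *)
have : tracked (fun x => iteri (n x) (fun k acc => f x (n x - k.+1) :: acc) [::]).
  by tracked_tac.
apply: tracked_ext => x.
suff iterE m : m <= n x ->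
    iteri m (fun k acc => f x (n x - k.+1) :: acc) [::] =
    map (f x) (iota (n x - m) m).
  by rewrite iterE // subnn.
elim: m => //= m IHm ltm; rewrite IHm 1?ltnW //; congr (_ :: map _ (iota _ _)).
by rewrite subnSK.
Qed.

Lemma tracked_has {R : Type} {cR : coded R} (n : R -> nat) (P : R -> nat -> bool) :
  tracked n -> tracked2 P -> tracked (fun x => has (P x) (iota 0 (n x))).
Proof.
move=> cn cP.
have : tracked (fun x => iteri (n x) (fun k acc => acc || P x k) false) by tracked_tac.
apply: tracked_ext => x; elim: (n x) => // m IHm.
by rewrite -[in RHS]addn1 iotaD has_cat -IHm /= orbF.
Qed.

(** The number of leading indices below [n] before [P] first fails; it is [n] if [P] never fails, as
    [find] then returns the length of the list. *)
Definition run (P : pred nat) n := find (predC P) (iota 0 n).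

Lemma tracked_run {R : Type} {cR : coded R} (n : R -> nat) (P : R -> nat -> bool) :
  tracked n -> tracked2 P -> tracked (fun x => run (P x) (n x)).
Proof.
move=> cn cP.
(* The accumulator equals the current index exactly as long as [P] has not failed. *)
have : tracked (fun x => iteri (n x)
    (fun k acc => if (acc == k) && P x k then k.+1 else acc) 0) by tracked_tac.
apply: tracked_ext => x; rewrite /run; elim: (n x) => // m IHm.
rewrite iteriS IHm -[in RHS]addn1 iotaD find_cat has_find size_iota.
have := find_size (predC (P x)) (iota 0 m); rewrite size_iota leq_eqVlt.
case: eqP => [->|] /=; last by move=> ? ->.
by rewrite ltnn; case: (P x m) => /=; lia.
Qed.

Lemma run_sound (P : pred nat) n k : k < run P n -> P k.
Proof.
move=> ltk; have lekn : k < n.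
  by apply: leq_trans ltk _; rewrite -[n in _ <= n](size_iota 0) find_size.
by have := before_find 0 ltk; rewrite nth_iota //= => /negbFE.
Qed.

Lemma leq_run (P : pred nat) n m :
  m <= n -> (forall k, k < m -> P k) -> m <= run P n.
Proof.
move=> lemn Pm; rewrite leqNgt; apply/negP => lt_run.
have lt_size : run P n < size (iota 0 n).
  by rewrite size_iota; apply: leq_trans lt_run lemn.
have := lt_size; rewrite -has_find => /(nth_find 0).
rewrite -/(run P n) nth_iota ?add0n; last by rewrite size_iota in lt_size.
by rewrite /= Pm.
Qed.

(** [P k] is meant to say that entry [k] is already known; cutting at the first unknown entry leaves
    an initial segment of the intended sequence. *)
Definition sample (P : pred nat) (g : nat -> nat) n : word := mkseq g (run P n).

Lemma tracked_sample {R : Type} {cR : coded R} (n : R -> nat) (P : R -> nat -> bool)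
    (g : R -> nat -> nat) :
  tracked n -> tracked2 P -> tracked2 g -> tracked (fun x => sample (P x) (g x) (n x)).
Proof. by move=> cn cP cg; apply: tracked_mkseq => //; apply: tracked_run. Qed.

Lemma tracked_take : tracked2 (take : nat -> word -> word).
Proof.
have : tracked2 (fun n (s : word) => mkseq (nth 0 s) (size s - (size s - n))).
  by apply: (tracked_mkseq (f := fun x => nth 0 x.2)); rewrite /tracked2; tracked_tac.
apply: tracked_ext => -[n s] /=; apply: (@eq_from_nth _ 0).
  by rewrite size_mkseq size_take_min -minnE minnC.
by rewrite size_mkseq => i lti; rewrite nth_mkseq // nth_take //; lia.
Qed.

#[local] Hint Resolve tracked_take : tracked.

Lemma tracked_prefix : tracked2 (@prefix nat : word -> word -> bool).
Proof.
have : tracked2 (fun u v : word =>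
    CodeSeq.code (take (size u) v) == CodeSeq.code u) by rewrite /tracked2; tracked_tac.
by apply: tracked_ext => x; rewrite prefixE (can_eq CodeSeq.codeK).
Qed.

#[local] Hint Resolve tracked_prefix : tracked.

Lemma tracked_cantor_of_nat : tracked Cantor.of_nat.
Proof.
have : tracked (fun n => iteri n (fun _ p => if p.1 == 0 then (p.2.+1, 0)
                                         else (p.1.-1, p.2.+1)) (0, 0)).
  by tracked_tac.
apply: tracked_ext; rewrite /Cantor.of_nat; elim=> //= n ->.
by case: (nat_rec _ _ _ n) => -[].
Qed.

Lemma tracked_cantor_to_nat : tracked Cantor.to_nat.
Proof.
have : tracked (fun p => p.2 + iteri (p.2 + p.1) (fun i acc => i.+1 + acc) 0).
  by tracked_tac.
apply: tracked_ext => -[x y] /=; congr addn.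
Qed.

#[local] Hint Resolve tracked_cantor_of_nat tracked_cantor_to_nat : tracked.

Lemma tracked_word phi : tracked (phi : word -> word) <-> computable_word phi.
Proof.
split=> [[g recg gphi]|comp_phi].
  have := recg; congr recursive; apply/funext => x.
  by rewrite -[thead x]CodeSeq.decodeK CodeSeq.codeK; exact: gphi.
exists (fun n => CodeSeq.code (phi (CodeSeq.decode n))) => // w.
by rewrite /enc /= CodeSeq.codeK.
Qed.

(** * Converging sequences of words *)

(* The word functions below preserve [conv] but need not be monotone;
   monotonicity is restored at the end by [monotonize]. *)
Definition conv (s : nat -> word) (r : baire) : Prop :=
  (forall n, cylinder (s n) r) /\
  (forall k, exists m, forall n, m <= n -> k <= size (s n)).

Lemma cylinderP (w : word) (r : baire) :
  cylinder w r <-> forall k, k < size w -> nth 0 w k = r k.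
Proof.
split=> [wr k ltk|wr]; first by rewrite -[w in LHS]wr nth_mkseq.
apply: (@eq_from_nth _ 0); rewrite size_mkseq // => k ltk.
by rewrite nth_mkseq // wr.
Qed.

Lemma cylinder_prefix (u v : word) (r : baire) :
  prefix u v -> cylinder v r -> cylinder u r.
Proof.
move=> /prefixP [s ->] /cylinderP vr; apply/cylinderP => k ltk.
by rewrite -vr ?nth_cat ?ltk // size_cat ltn_addr.
Qed.

Lemma prefix_cylinder (u v : word) (r : baire) :
  cylinder u r -> cylinder v r -> size u <= size v -> prefix u v.
Proof.
move=> ur vr le; rewrite prefixE; apply/eqP/(@eq_from_nth _ 0).
  by rewrite size_takel.
rewrite size_takel // => k ltk; rewrite nth_take //.
by rewrite (cylinderP u r).1 // (cylinderP v r).1 //; apply: leq_trans ltk le.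
Qed.

Lemma cylinder_mkseq (r : baire) n : cylinder (mkseq r n) r.
Proof. by rewrite /cylinder /= size_mkseq. Qed.

Lemma conv_mkseq (r : baire) (l : nat -> nat) :
  (forall n, n <= l n) -> conv (fun n => mkseq r (l n)) r.
Proof.
move=> ln; split=> [n|k]; first exact: cylinder_mkseq.
by exists k => n lekn; rewrite size_mkseq; apply: leq_trans lekn _.
Qed.

(* A single term of a converging sequence can be replaced by any initial
   segment of the limit; this makes soundness at arbitrary arguments a
   consequence of preservation of convergence. *)
Lemma conv_update s r n0 w :
  conv s r -> cylinder w r -> conv (fun n => if n == n0 then w else s n) r.
Proof.
move=> [sr unb] wr; split=> [n|k]; first by case: eqP.
have [m mP] := unb k; exists (maxn m n0.+1) => n; rewrite geq_max => /andP [lemn lt].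
by rewrite (gtn_eqF lt) mP.
Qed.

(** Known entries are correct, and each entry is known from some stage on; a maximum over the first
    [k] entries gives a stage from which all of them are known. *)
Lemma conv_sample (P : nat -> pred nat) (g : nat -> nat -> nat) (l : nat -> nat) r :
  (forall n k, P n k -> g n k = r k) ->
  (forall k, exists m, forall n, m <= n -> P n k) ->
  (forall k, exists m, forall n, m <= n -> k <= l n) ->
  conv (fun n => sample (P n) (g n) (l n)) r.
Proof.
move=> Pg evP unb; split=> [n|k].
  apply/cylinderP => k; rewrite size_mkseq => ltk.
  by rewrite nth_mkseq // Pg //; apply: run_sound ltk.
have [m mP] : exists m, forall n, m <= n -> forall j, j < k -> P n j.
  elim: k => [|k [m mP]]; first by exists 0.
  have [m' m'P] := evP k; exists (maxn m m') => n.
  rewrite geq_max => /andP [le le'] j; rewrite ltnS leq_eqVlt => /orP [/eqP ->|].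
    exact: m'P.
  exact: mP.
have [m' m'P] := unb k; exists (maxn m m') => n; rewrite geq_max => /andP [le le'].
by rewrite size_mkseq leq_run ?m'P //; apply: mP.
Qed.

(** * Projections, pairing and application of names on approximations *)

Definition subword (g : nat -> nat) (v : word) : word :=
  sample (fun k => g k < size v) (fun k => nth 0 v (g k)) (size v).

Lemma conv_subword g s r : conv s r -> conv (fun n => subword g (s n)) (r \o g).
Proof.
move=> [sr unb]; apply: conv_sample => [n k|k|//]; first exact: (cylinderP _ _).1.
exact: unb.
Qed.

Definition evens := subword double.
Definition odds := subword (fun k => k.*2.+1).
Definition component i := subword (fun j => Cantor.to_nat (i, j)).

Lemma tracked_evens : tracked evens.
Proof. by apply: tracked_sample; rewrite /tracked2; tracked_tac. Qed.

Lemma tracked_odds : tracked odds.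
Proof. by apply: tracked_sample; rewrite /tracked2; tracked_tac. Qed.

Lemma tracked_component : tracked2 component.
Proof.
by apply: (tracked_sample (n := fun x => size x.2)); rewrite /tracked2; tracked_tac.
Qed.

#[local] Hint Resolve tracked_evens tracked_odds tracked_component : tracked.

Lemma tuple2_even q p k : tuple2 q p k.*2 = q k.
Proof. by rewrite /tuple2 odd_double doubleK. Qed.

Lemma tuple2_odd q p k : tuple2 q p k.*2.+1 = p k.
Proof. by rewrite /tuple2 /= odd_double /= uphalf_double. Qed.

Lemma tupleN_to_nat ps i j : tupleN ps (Cantor.to_nat (i, j)) = ps i j.
Proof. by rewrite /tupleN Cantor.cancel_of_to. Qed.

Lemma conv_evens s q p : conv s (tuple2 q p) -> conv (fun n => evens (s n)) q.
Proof.
move/(conv_subword double); congr conv.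
by apply/funext => k; rewrite /= tuple2_even.
Qed.

Lemma conv_odds s q p : conv s (tuple2 q p) -> conv (fun n => odds (s n)) p.
Proof.
move/(conv_subword (fun k => k.*2.+1)); congr conv.
by apply/funext => k; rewrite /= tuple2_odd.
Qed.

Lemma conv_component s ps i :
  conv s (tupleN ps) -> conv (fun n => component i (s n)) (ps i).
Proof.
move/(conv_subword (fun j => Cantor.to_nat (i, j))); congr conv.
by apply/funext => j; rewrite /= tupleN_to_nat.
Qed.

Definition interleave (u v : word) : word :=
  sample (fun k => k./2 < size (if odd k then v else u))
         (fun k => nth 0 (if odd k then v else u) k./2) (size u + size v).

Lemma tracked_interleave : tracked2 interleave.
Proof.
by apply: (tracked_sample (n := fun x => size x.1 + size x.2));
  rewrite /tracked2; tracked_tac.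
Qed.

#[local] Hint Resolve tracked_interleave : tracked.

Lemma conv_interleave s t q p :
  conv s q -> conv t p -> conv (fun n => interleave (s n) (t n)) (tuple2 q p).
Proof.
move=> [sq unbs] [tp unbt]; apply: conv_sample => [n k|k|k].
- by rewrite /tuple2; case: odd; apply: (cylinderP _ _).1.
- by case: odd; [exact: unbt | exact: unbs].
- by have [m mP] := unbs k; exists m => n /mP le; apply: leq_trans (leq_addr _ _).
Qed.

(** Approximates [Phi q p] from initial segments of [q] and [p]. The word function named by [q] is
    evaluated at all initial segments of [p] whose codes lie below [size s], and a longest value is
    kept, since that function need not be monotone. *)
Definition apply_name (s p : word) : word :=
  iteri (size p).+1 (fun k acc =>
    let c := CodeSeq.code (take k p) in
    let v := CodeSeq.decode (nth 0 s c) in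
    if (c < size s) && (size acc < size v) then v else acc) [::].

Lemma tracked_apply_name : tracked2 apply_name.
Proof. by rewrite /tracked2 /apply_name; tracked_tac. Qed.

#[local] Hint Resolve tracked_apply_name : tracked.

Lemma size_apply_name (s p : word) k :
  k <= size p -> CodeSeq.code (take k p) < size s ->
  size (CodeSeq.decode (nth 0 s (CodeSeq.code (take k p)))) <= size (apply_name s p).
Proof.
rewrite -ltnS /apply_name; elim: (size p).+1 => // m IHm.
rewrite ltnS leq_eqVlt => /orP [/eqP ->|ltk] lts /=.
  by rewrite lts /=; case: ltnP.
apply: leq_trans (IHm ltk lts) _; case: ifP => // /andP [_]; exact: ltnW.
Qed.

(** Every value kept is taken at an initial segment of [p], hence correct. A word [w] with a long
    value is inspected once [s n] reaches beyond its code and [t n] extends it. *)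
Lemma conv_apply_name s t q p r :
  conv s q -> conv t p -> Phi q p r -> conv (fun n => apply_name (s n) (t n)) r.
Proof.
move=> [sq unbs] [tp unbt] [rP unbr]; split=> [n|k].
  rewrite /apply_name; elim: (size (t n)).+1 => // m IHm /=.
  case: ifP => // /andP [lts _].
  rewrite ((cylinderP _ _).1 (sq n)) //; apply: rP.
  exact: cylinder_prefix (prefix_take _ _) (tp n).
have [w wp lew] := unbr k.
have [m1 m1P] := unbs (CodeSeq.code w).+1; have [m2 m2P] := unbt (size w).
exists (maxn m1 m2) => n; rewrite geq_max => /andP [/m1P lts /m2P ltt].
have tE : take (size w) (t n) = w.
  by apply/eqP; rewrite -prefixE; apply: prefix_cylinder (tp n) ltt.
apply: leq_trans lew _; have := @size_apply_name (s n) (t n) (size w) ltt.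
by rewrite tE => /(_ lts); rewrite ((cylinderP _ _).1 (sq n)).
Qed.

Lemma conv_is_sup phi s p r :
  monotone_word phi -> is_sup phi p r -> conv s p -> conv (fun n => phi (s n)) r.
Proof.
move=> mon [rP unbr] [sp unbs]; split=> [n|k]; first exact: rP.
have [w wp lew] := unbr k; have [m mP] := unbs (size w).
exists m => n /mP le; apply: leq_trans lew _.
exact: size_prefix (mon _ _ (prefix_cylinder wp (sp n) le)).
Qed.

(** * Monotone word functions from convergent ones *)

Definition monotonize_step (phi : word -> word) (w : word) k (acc : word) : word :=
  let v := phi (take k w) in if prefix acc v then v else acc.

Definition monotonize (phi : word -> word) (w : word) : word :=
  iteri (size w).+1 (monotonize_step phi w) [::].

Lemma tracked_monotonize phi : tracked phi -> tracked (monotonize phi).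
Proof. by move=> cphi; rewrite /monotonize /monotonize_step; tracked_tac. Qed.

Lemma monotone_monotonize phi : monotone_word (monotonize phi).
Proof.
move=> u v puv; rewrite /monotonize.
set F := monotonize_step phi.
have grow m d w : prefix (iteri m (F w) [::]) (iteri (m + d) (F w) [::]).
  elim: d => [|d IHd]; first by rewrite addn0 prefix_refl.
  apply: prefix_trans IHd _; rewrite addnS /= {2}/F /monotonize_step.
  by case: ifP => // _; exact: prefix_refl.
have /prefixP [s vE] := puv.
(* The first [(size u).+1] rounds only look at initial segments of [u], which [u] and [v] share. *)
have agree m : m <= (size u).+1 -> iteri m (F u) [::] = iteri m (F v) [::].
  elim: m => //= m IHm ltm; rewrite IHm 1?ltnW // /F /monotonize_step vE.
  by rewrite take_cat; move: ltm; rewrite ltnS leq_eqVlt => /orP [/eqP -> | ->];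
    rewrite ?ltnn ?subnn ?take0 ?cats0 ?take_size.
rewrite agree // vE size_cat -addSn; exact: grow.
Qed.

(** Along [p] all values are initial segments of [r], hence comparable. A value is rejected only if
    the accumulator is already longer, so nothing is lost. *)
Lemma is_sup_monotonize phi p r :
  conv (fun n => phi (mkseq p n)) r -> is_sup (monotonize phi) p r.
Proof.
move=> [phir unb]; pose F := monotonize_step phi.
have takeE (w : word) k : cylinder w p -> k <= size w -> take k w = mkseq p k.
  by move=> wp lek; apply/eqP; have := prefix_cylinder (cylinder_mkseq p k) wp;
    rewrite size_mkseq prefixE size_mkseq => ->.
have sound w m : cylinder w p -> m <= (size w).+1 -> cylinder (iteri m (F w) [::]) r.
  move=> wp; elim: m => //= m IHm ltm; rewrite {1}/F {1}/monotonize_step.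
  by rewrite takeE //; case: ifP => _; [exact: phir | exact: IHm (ltnW ltm)].
split=> [w wp|k]; first exact: (sound w).
have [m /(_ m (leqnn m)) lek] := unb k.
exists (mkseq p m); first exact: cylinder_mkseq.
rewrite /monotonize size_mkseq /= {1}/monotonize_step.
rewrite take_oversize ?size_mkseq //.
case: ifPn => // /negP npre; apply: leq_trans lek _.
rewrite leqNgt; apply/negP => lt; apply: npre.
apply: (prefix_cylinder _ (phir m) (ltnW lt)).
by apply: sound; [exact: cylinder_mkseq | rewrite size_mkseq].
Qed.

(** * The reduction of the loop *)

Section Algorithm.
Variables phiH phiK : word -> word.

(** One loop step on approximations: [x] stands for a pair of a name [q] and an instance [p], [a]
    for a point of the closed set computed from [p]; the name [q] is applied to the solution that
    [phiH] computes from [p] and [a]. *)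
Definition step_word (x a : word) : word :=
  apply_name (evens x) (phiH (interleave (odds x) a)).

Definition state_word i (x t : word) : word :=
  iteri i (fun k acc => step_word acc (component k t)) x.

Definition history_word (x t : word) : word :=
  sample (fun n => (Cantor.of_nat n).2 < size (state_word (Cantor.of_nat n).1 x t))
    (fun n => nth 0 (state_word (Cantor.of_nat n).1 x t) (Cantor.of_nat n).2)
    (size x).

Definition loopH : word -> word :=
  monotonize (fun v => history_word (evens v) (odds v)).

(** An entry 0 of [b] lists no word, and a positive entry is the successor of the code of a listed
    word. *)
Definition excluded_at (x w : word) i : bool :=
  let b := phiK (odds (state_word i x w)) in
  has (fun l => (0 < nth 0 b l) &&
                @prefix nat (CodeSeq.decode (nth 0 b l).-1) (component i w))
      (iota 0 (size b)).

Definition excluded (x w : word) : bool :=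
  has (excluded_at x w) (iota 0 (size w)).

(** Each word is tested once, at the stage given by its code and with that many entries of [x]. This
    suffices because longer initial segments of the same sequence are tested too, with arbitrarily
    much of [x]. *)
Definition loopK (x : word) : word :=
  mkseq (fun n => if excluded (take n x) (CodeSeq.decode n) then n.+1 else 0)
        (size x).

Lemma tracked_step_word : tracked phiH -> tracked2 step_word.
Proof. by move=> cH; rewrite /tracked2 /step_word; tracked_tac. Qed.

Lemma tracked_state_word : tracked phiH -> tracked3 state_word.
Proof.
by move=> /tracked_step_word cs; rewrite /tracked3 /state_word; tracked_tac.
Qed.

Lemma computable_loopH : computable_word phiH -> computable_word loopH.
Proof.
move=> /tracked_word/tracked_state_word cs; apply/tracked_word/tracked_monotonize.
by apply: tracked_sample; rewrite /tracked2; tracked_tac.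
Qed.

Lemma computable_loopK :
  computable_word phiH -> computable_word phiK -> computable_word loopK.
Proof.
move=> /tracked_word/tracked_state_word cs /tracked_word cK; apply/tracked_word.
have cat : tracked3 excluded_at.
  apply: (tracked_has (n := fun x : word * word * nat =>
    size (phiK (odds (state_word x.2 x.1.1 x.1.2))))
    (P := fun x l => let b := phiK (odds (state_word x.2 x.1.1 x.1.2)) in
      (0 < nth 0 b l) &&
      @prefix nat (CodeSeq.decode (nth 0 b l).-1) (component x.2 x.1.2))).
    by tracked_tac.
  by rewrite /tracked2; tracked_tac.
have cex : tracked2 excluded.
  apply: (tracked_has (n := fun x : word * word => size x.2)
    (P := fun x i => excluded_at x.1 x.2 i)).
    by tracked_tac.
  by rewrite /tracked2; tracked_tac.
apply: (tracked_mkseq (n := size)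
  (f := fun x n => if excluded (take n x) (CodeSeq.decode n) then n.+1 else 0)).
  by tracked_tac.
by rewrite /tracked2; tracked_tac.
Qed.

Lemma monotone_loopK : monotone_word loopK.
Proof.
move=> u v /prefixP [w ->]; rewrite /loopK size_cat /mkseq iotaD map_cat.
rewrite [X in prefix X](_ : _ = [seq if excluded (take n (u ++ w))
    (CodeSeq.decode n) then n.+1 else 0 | n <- iota 0 (size u)]) ?prefix_prefix //.
(* Entry [n] depends on the first [n] entries of the input only. *)
apply/eq_in_map => n; rewrite mem_iota => /andP [_ ltn].
by rewrite take_cat ltn.
Qed.

Definition loopK_name (x : baire) : baire :=
  fun n => if excluded (mkseq x n) (CodeSeq.decode n) then n.+1 else 0.

Lemma is_sup_loopK x : is_sup loopK x (loopK_name x).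
Proof.
split=> [w wx|k].
  apply/cylinderP => k; rewrite size_mkseq => ltk.
  rewrite nth_mkseq // /loopK_name; congr (if excluded _ _ then _ else _).
  have := prefix_cylinder (cylinder_mkseq x k) wx.
  by rewrite size_mkseq prefixE size_mkseq => /(_ (ltnW ltk))/eqP.
by exists (mkseq x k); [exact: cylinder_mkseq | rewrite !size_mkseq].
Qed.

Lemma listed_loopK x w :
  listed (loopK_name x) w <-> excluded (mkseq x (CodeSeq.code w)) w.
Proof.
rewrite /listed /loopK_name; split=> [[n] | ex].
  by case: ifP => // ex [nE]; rewrite -nE -[w]CodeSeq.codeK -nE.
by exists (CodeSeq.code w); rewrite CodeSeq.codeK ex.
Qed.

End Algorithm.

(** The closed subset of [A] with negative name [b], written without the represented space of closed
    subsets. *)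
Definition legal (A : set baire) (b : baire) : set baire :=
  [set a | A a /\ forall w, listed b w -> ~ cylinder w a].

(* [phiH] and [phiK] are the outer and the inner reduction, and [Q] selects the
   closed sets that choice is applied to. *)
Definition choice_reduction (A : set baire) (Q : set (set baire))
    (phiH phiK : word -> word) (f : mfun baire baire) : Prop :=
  forall p, mdom f p -> exists b,
    [/\ is_sup phiK p b, Q (legal A b)
      & forall a, legal A b a -> exists2 r, is_sup phiH (tuple2 p a) r & f p r].

(** * Correctness: legal sequences are the runs of the loop *)

Section Loop.
Variables (A : set baire) (phiH phiK : word -> word) (f : mfun baire baire).
Hypotheses (monH : monotone_word phiH) (monK : monotone_word phiK).
Hypothesis red : choice_reduction A (fun B => B !=set0)%classic phiH phiK f.

(** A loop step that passes through the point [a] of the closed set. Unlike [loop_step], it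
    determines [y] from [x] and [a]. *)
Definition link (x a y : baire) : Prop := exists q p b r,
  [/\ x = tuple2 q p, is_sup phiK p b, legal A b a
    & [/\ is_sup phiH (tuple2 p a) r, f p r & Phi q r y]].

Lemma link_step x a y : link x a y -> loop_step f x y.
Proof.
move=> [q [p [b [r [-> _ _ [_ fpr Py]]]]]].
by exists (tuple2 q r); [exists q, p, r | exists q, r].
Qed.

Lemma link_ex x : mdom (loop_step f) x -> exists q p b,
  [/\ x = tuple2 q p, is_sup phiK p b, (legal A b !=set0)%classic
    & forall a, legal A b a -> exists y, link x a y].
Proof.
move=> [[q [p [-> /red [b [Kb Qb bP]]]]] domU]; exists q, p, b; split=> // a la.
have [r Hr fpr] := bP a la.
have [|y [q' [r' [/tuple2_inj [<- <-] Py]]]] := domU (tuple2 q r).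
  by exists q, p, r.
by exists y, q, p, b, r.
Qed.

Lemma link_functional x a y y' : link x a y -> link x a y' -> y = y'.
Proof.
move=> [q [p [b [r [-> _ _ [Hr _ Py]]]]]].
move=> [q' [p' [b' [r' [/tuple2_inj [<- <-] _ _ [Hr' _ Py']]]]]].
rewrite (is_sup_unique Hr Hr') in Py; exact: (is_sup_unique Py Py').
Qed.

(** Links are assumed below [n] only, so that the lemma also applies while a run is still being
    constructed. *)
Lemma conv_state_word q a n s t :
  (forall i, i < n -> link (q i) (a i) (q i.+1)) ->
  conv s (q 0) -> conv t (tupleN a) ->
  conv (fun m => state_word phiH n (s m) (t m)) (q n).
Proof.
move=> linkP sq ta; elim: n linkP => // n IHn linkP.
have [|qq [p [b [r [xE _ _ [Hr _ Py]]]]]] := linkP n; first exact: ltnSn.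
have cx : conv (fun m => state_word phiH n (s m) (t m)) (tuple2 qq p).
  by rewrite -xE; apply: IHn => i lti; apply: linkP; apply: ltnW.
rewrite /state_word /= -/(state_word _ _ _ _).
apply: (conv_apply_name (conv_evens cx) _ Py).
apply: (conv_is_sup monH Hr); apply: conv_interleave (conv_component _ ta).
exact: conv_odds cx.
Qed.

Variable x0 : baire.
Hypothesis dom_x0 : mdom (loop f) x0.

(** An exclusion is always justified: the approximations it uses are correct along a run, so a
    listed word with an initial segment of [a i] excluded would contradict the legality of [a i]. *)
Lemma link_chain_legal a q :
  q 0 = x0 -> (forall i, link (q i) (a i) (q i.+1)) ->
  legal (sequences_in A) (loopK_name phiH phiK x0) (tupleN a).
Proof.
move=> q0 linkP; split.
  exists a; split=> // i.
  by have [? [? [? [? [_ _ [Aa _] _]]]]] := linkP i.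
move=> w /listed_loopK ex wa; move: ex; rewrite /excluded.
set x := mkseq _ _ => /hasP [i _] /hasP [l]; rewrite mem_iota => /andP [_ ltl].
have [qq [p [b [r [xE Kb [_ nl] _]]]]] := linkP i.
(* The words that caused the exclusion are placed at index 0 of convergent sequences; convergence
   then gives soundness at index 0. *)
have cx : conv (fun m => if m == 0 then x else mkseq x0 m) (q 0).
  rewrite q0; apply: conv_update; last exact: cylinder_mkseq.
  exact: (@conv_mkseq _ id).
have ct : conv (fun m => if m == 0 then w else mkseq (tupleN a) m) (tupleN a).
  by apply: conv_update => //; exact: (@conv_mkseq _ id).
have := conv_state_word (n := i) (fun j _ => linkP j) cx ct.
rewrite xE => /conv_odds/(conv_is_sup monK Kb) [/(_ 0) /= /cylinderP sound _].
have [/(_ 0) /= wai _] := conv_component i ct.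
rewrite sound //; move=> /andP [b_gt0 /cylinder_prefix/(_ wai)].
by apply: nl; exists l; rewrite CodeSeq.decodeK prednK.
Qed.

(** The run is built step by step. If component [m] left its set, a listed word would be an initial
    segment of it, and a long enough initial segment of [t] would be excluded. *)
Lemma legal_link_chain t :
  legal (sequences_in A) (loopK_name phiH phiK x0) t ->
  exists a q, [/\ t = tupleN a, q 0 = x0 & forall i, link (q i) (a i) (q i.+1)].
Proof.
move=> [[a [Aa ->]] nl].
pose next x a := xget x [set y | link x a y]%classic.
pose q := fix q i := if i is j.+1 then next (q j) (a j) else x0.
exists a, q; split=> // n.
(* The induction also carries reachability of [q n], which puts it in the domain of the loop step,
   and all earlier links. *)
suff [_ _] : [/\ iter n (mimage (loop_step f)) [set x0]%classic (q n),
    forall i, i < n -> link (q i) (a i) (q i.+1) & link (q n) (a n) (q n.+1)] by [].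
have linkS m : iter m (mimage (loop_step f)) [set x0]%classic (q m) ->
    (forall i, i < m -> link (q i) (a i) (q i.+1)) -> link (q m) (a m) (q m.+1).
  move=> qm linkP.
  have [qq [p [b [xE Kb _ bP]]]] := link_ex (dom_x0 qm).
  suff /bP [y ly] : legal A b (a m) by exact: (xgetPex (q m) (ex_intro _ y ly)).
  split=> // v [l bl] va.
  pose s := tupleN a.
  have ct : conv (mkseq s) s by exact: (@conv_mkseq _ id).
  (* This is the part of [x0] available when [mkseq s n] is tested; its length is at least [n] by
     [size_code]. *)
  have cx : conv (fun n => mkseq x0 (CodeSeq.code (mkseq s n))) x0.
    apply: (@conv_mkseq _ (fun n => CodeSeq.code (mkseq s n))) => k.
    by rewrite -{1}(size_mkseq s k) size_code.
  have := conv_state_word (n := m) linkP cx ct.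
  rewrite xE => /conv_odds/(conv_is_sup monK Kb) [/= sound /(_ l.+1) [m1 m1P]].
  have [soundv /(_ (size v)) [m2 m2P]] := conv_component m ct.
  (* Long enough for [m] to be among the tested components, for entry [l] of the list to be
     computed, and for component [m] to cover [v]. *)
  pose k := maxn m.+1 (maxn m1 m2).
  have lek1 : m1 <= k by rewrite /k; lia.
  have lek2 : m2 <= k by rewrite /k; lia.
  apply: (nl (mkseq s k)); last exact: cylinder_mkseq.
  apply/listed_loopK/hasP; exists m; first by rewrite mem_iota size_mkseq /k /=; lia.
  apply/hasP; exists l; first by rewrite mem_iota /= m1P.
  rewrite ((cylinderP _ _).1 (sound k)) ?m1P // bl /= CodeSeq.codeK.
  exact: prefix_cylinder va (soundv k) (m2P _ lek2).
elim: n => [|n [qn linkP ln]]; first by split=> //; apply: linkS.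
have qSn : iter n.+1 (mimage (loop_step f)) [set x0]%classic (q n.+1).
  by exists (q n) => //; apply: link_step ln.
have linkP' i : i < n.+1 -> link (q i) (a i) (q i.+1).
  by rewrite ltnS leq_eqVlt => /orP [/eqP ->|/linkP].
by split=> //; apply: linkS.
Qed.

Lemma legal_loop_nonempty :
  (legal (sequences_in A) (loopK_name phiH phiK x0) !=set0)%classic.
Proof.
have ex x : exists ay : baire * baire,
    mdom (loop_step f) x -> link x ay.1 ay.2.
  (* The pair [(x, x)] is a default outside the domain. *)
  case: (pselect (mdom (loop_step f) x)) => [/link_ex|nd]; last by exists (x, x).
  by move=> [q [p [b [_ _ [a la] /(_ a la) [y ly]]]]]; exists (a, y).
have [c cP] := boolp.choice ex.
pose q i := iter i (fun x => (c x).2) x0.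
have qP i : iter i (mimage (loop_step f)) [set x0]%classic (q i).
  elim: i => // i IHi; exists (q i) => //.
  by apply: link_step; apply: cP; apply: dom_x0 IHi.
exists (tupleN (fun i => (c (q i)).1)); apply: (link_chain_legal (q := q)) => // i.
exact: cP (dom_x0 (qP i)).
Qed.

Lemma legal_loop_history t :
  legal (sequences_in A) (loopK_name phiH phiK x0) t ->
  exists2 r, is_sup (loopH phiH) (tuple2 x0 t) r & loop f x0 r.
Proof.
move=> /legal_link_chain [a [q [-> q0 linkP]]]; exists (tupleN q); last first.
  by exists q; split=> // i; apply: link_step (linkP i).
apply: is_sup_monotonize.
have cxt : conv (mkseq (tuple2 x0 (tupleN a))) (tuple2 x0 (tupleN a)).
  exact: (@conv_mkseq _ id).
have ct := conv_odds cxt.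
have := conv_evens cxt; rewrite -[X in conv _ X]q0 => cx.
have cq i := conv_state_word (n := i) (fun j _ => linkP j) cx ct.
apply: conv_sample => [n k|k|k].
- rewrite [tupleN q k]/tupleN; case: (Cantor.of_nat k) => i j /=.
  exact: ((cylinderP _ _).1 ((cq i).1 n) j).
- exact: (cq _).2.
- exact: cx.2.
Qed.

End Loop.

Section LoopReduction.
Variables (A : set baire) (phiH phiK : word -> word) (f : mfun baire baire).
Hypotheses (monH : monotone_word phiH) (monK : monotone_word phiK).

Local Open Scope classical_set_scope.

Lemma loop_reduction :
  choice_reduction A (fun B => B !=set0) phiH phiK f ->
  choice_reduction (sequences_in A) (fun B => B !=set0)
    (loopH phiH) (loopK phiH phiK) (loop f).
Proof.
move=> red x0 dom_x0; exists (loopK_name phiH phiK x0); split.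
- exact: is_sup_loopK.
- exact: (legal_loop_nonempty monH monK red dom_x0).
- by move=> t; exact: (legal_loop_history monH monK red dom_x0).
Qed.

(** With singletons, a state admits only one point and hence only one successor, so by induction two
    legal sequences have the same run and the same points. *)
Lemma loop_unique_reduction :
  choice_reduction A (fun B => exists a, B = [set a]) phiH phiK f ->
  choice_reduction (sequences_in A) (fun B => exists a, B = [set a])
    (loopH phiH) (loopK phiH phiK) (loop f).
Proof.
move=> red.
have nered : choice_reduction A (fun B => B !=set0) phiH phiK f.
  move=> p /red [b [Kb [a aE] bP]]; exists b; split=> //.
  by rewrite aE; exists a.
move=> x0 dom_x0; exists (loopK_name phiH phiK x0); split.
- exact: is_sup_loopK.
- have [t lt] := legal_loop_nonempty monH monK nered dom_x0; exists t.
  apply/seteqP; split => [t'|_ -> //].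
  move=> /(legal_link_chain monH monK nered dom_x0) [a' [q' [-> q'0 link']]] /=.
  have [a [q [-> q0 linkP]]] := legal_link_chain monH monK nered dom_x0 lt.
  have link_unique x c c' y y' : mdom (loop_step f) x ->
      link A phiH phiK f x c y -> link A phiH phiK f x c' y' -> c' = c /\ y' = y.
    move=> [[q1 [p1 [-> /red [b [Kb [d bE] _]]]]] _] lc lc'.
    have cd e z : link A phiH phiK f (tuple2 q1 p1) e z -> e = d.
      move=> [q2 [p2 [b2 [r2 [/tuple2_inj [_ <-] Kb2 + _]]]]].
      by rewrite (is_sup_unique Kb2 Kb) bE.
    have cc' : c' = c by rewrite (cd _ _ lc) (cd _ _ lc').
    by split=> //; rewrite cc' in lc'; apply: link_functional lc' lc.
  have qP i : iter i (mimage (loop_step f)) [set x0] (q i).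
    elim: i => [//|i IHi]; exists (q i) => //; exact: link_step (linkP i).
  have qq' i : q' i = q i.
    elim: i => [|i IHi]; first by rewrite q0 q'0.
    have := link' i; rewrite IHi => l'.
    by have [_ ->] := link_unique _ _ _ _ _ (dom_x0 i _ (qP i)) (linkP i) l'.
  congr tupleN; apply/funext => i; have := link' i; rewrite !qq' => l'.
  by have [-> _] := link_unique _ _ _ _ _ (dom_x0 i _ (qP i)) (linkP i) l'.
- by move=> t; exact: (legal_loop_history monH monK nered dom_x0).
Qed.

End LoopReduction.

(** * Reductions to closed choice *)

Local Open Scope classical_set_scope.

Lemma open_cylinder (w : word) : open (cylinder w : set {ptws nat -> nat}).
Proof.
rewrite openE => p wp; rewrite /interior.
have near_p n : nbhs (p : {ptws nat -> nat})
    [set s | forall k, k < n -> s k = p k].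
  elim: n => [|n IHn]; first by apply: filterS filterT.
  have evn : continuous (fun s : {ptws nat -> nat} => s n) by exact: proj_continuous.
  apply: filterS (filterI IHn (evn p _ (discrete_set1 (p n)))).
  by move=> s [sk sn] k; rewrite ltnS leq_eqVlt => /orP [/eqP ->|/sk].
apply: filterS (near_p (size w)) => s sP; apply/cylinderP => k ltk.
by rewrite sP // (cylinderP w p).1.
Qed.

Lemma val_negative_name A p (B : relatively_closed A) :
  negative_name p B -> val B = legal A p.
Proof.
rewrite /negative_name => BE; have [C _ VB] := set_valP B.
have subA a : val B a -> A a by rewrite VB => -[].
apply/seteqP; split=> a /=.
  move=> Ba; split=> [|w lw wa]; first exact: subA.
  have : (A `&` \bigcup_(w in listed p) cylinder w) a.
    by split; [exact: subA | exists w].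
  by rewrite -BE => -[].
move=> [Aa nl]; apply: contrapT => nBa.
have : (A `\` val B) a by split.
by rewrite BE => -[_ [w lw wa]]; exact: (nl w).
Qed.

(** Every sequence is a negative name, so instances of choice can be replaced by sequences. *)
Lemma negative_name_legal A p :
  exists2 B : relatively_closed A, negative_name p B & val B = legal A p.
Proof.
pose O := \bigcup_(w in listed p) (cylinder w : set {ptws nat -> nat}).
have rc : relatively_closed A (legal A p).
  exists (~` O).
    by apply: open_closedC; apply: bigcup_open => w _; exact: open_cylinder.
  apply/seteqP; split=> a [Aa nO]; split=> //.
    by move=> [w lw wa]; exact: (nO w).
  by move=> w lw wa; apply: nO; exists w.
exists (exist _ (legal A p) (mem_set rc)) => //=.
rewrite /negative_name /=; apply/seteqP; split=> a [Aa aP]; split=> //.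
  by apply: contrapT => nO; apply: aP; split=> // w lw wa; apply: nO; exists w.
by move=> [_ nl]; have [w lw wa] := aP; exact: (nl w).
Qed.

(* [closed_choice] and [unique_choice] are, by conversion, the cases of the
   nonempty sets and of the singletons. *)
Definition choice_on (A : set baire) (Q : set (set baire)) :
    mfun (closed_subsets A) (subspace_rep A) :=
  Mfun [set B : relatively_closed A | Q (val B)] (mval (closed_choice A)).

Lemma mdom_realizer_version (X Y : repspace) (f : mfun X Y) p :
  mdom (realizer_version f) p <-> mdom (mcomp f (delta X)) p.
Proof. by split=> [[]|dp] //; split=> // y _; exact: delta_surj. Qed.

(** * Weihrauch reductions to choice in terms of names *)

Section ChoiceOn.
Variables (A : set baire) (Q : set (set baire)).
Let g := choice_on A Q.

Lemma mdom_choice_on b :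
  mdom (mcomp g (delta (closed_subsets A))) b <-> Q (legal A b).
Proof.
split=> [[[B bB] sub]|Qb].
  by have := sub _ bB; rewrite /= (val_negative_name bB).
have [B bB BE] := negative_name_legal A b; split; first by exists B.
move=> B' bB' /=; by rewrite (val_negative_name bB').
Qed.

Lemma mval_choice_on b (x : A) :
  mval (mcomp g (delta (closed_subsets A))) b x <-> legal A b (val x).
Proof.
split=> [[B bB] /=|lx]; first by rewrite (val_negative_name bB).
by have [B bB BE] := negative_name_legal A b; exists B; rewrite //= BE.
Qed.

Lemma graph_of_choice_functional (c : baire -> baire) b a a' :
  Q (legal A b) /\ a = c b -> Q (legal A b) /\ a' = c b -> a = a'.
Proof. by move=> [_ ->] [_ ->]. Qed.

(** The graph is restricted to names in the domain of choice, so that a value at [b] yields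
    [Q (legal A b)]. *)
Definition graph_of_choice c := Pmap (@graph_of_choice_functional c).

Lemma realizes_graph_of_choice c :
  (forall b, Q (legal A b) -> legal A b (c b)) -> realizes (graph_of_choice c) g.
Proof.
move=> cP b /mdom_choice_on Qb; have lc := cP b Qb; have [Ac _] := lc.
exists (c b), (exist _ (c b) (mem_set Ac)); split=> //.
exact/mval_choice_on.
Qed.

(** Every legal point is the answer of some realizer of choice, so quantifying over realizers
    amounts to quantifying over the legal points at each instance. *)
Lemma weihrauch_choice_on (X Y : repspace) (f : mfun X Y) :
  (forall B, Q B -> B !=set0) ->
  weihrauch f g <-> exists phiH phiK,
    [/\ computable_word phiH, computable_word phiK, monotone_word phiH,
        monotone_word phiK
      & choice_reduction A Q phiH phiK (realizer_version f)].
Proof.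
move=> Qne; split.
  move=> [H [K [[phiH [cH mH supH]] [phiK [cK mK supK]] red]]].
  exists phiH, phiK; split=> // p /mdom_realizer_version dp.
  have ex b : exists a, Q (legal A b) -> legal A b a.
    case: (pselect (Q (legal A b))) => [/[dup] Qb /Qne [a la]|nQ]; last by exists b.
    by exists a.
  have [c cP] := boolp.choice ex.
  have use c' : (forall b, Q (legal A b) -> legal A b (c' b)) ->
      exists b r, [/\ K p b, Q (legal A b), H (tuple2 p (c' b)) r
        & realizer_version f p r].
    move=> /realizes_graph_of_choice /red /(_ _ dp).
    move=> [r [y [[_ [_ [_ [<- [b Kb [Qb ->]] ->]]] Hr] ry fy]]].
    by exists b, r; split=> //; exists y.
  have [b [_ [Kb Qb _ _]]] := use c cP.
  exists b; split=> // [|a la]; first exact: supK.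
  (* The realizer is changed at [b] to answer with the given point [a]; functionality of [K] ensures
     that it is queried at [b]. *)
  pose c' b' := if pselect (b' = b) is left _ then a else c b'.
  have [b'|b' [r [Kb' _ Hr fr]]] := use c'.
    by rewrite /c'; case: pselect => [-> _|_ /cP].
  exists r => //; apply: supH; move: Hr.
  by rewrite (graph_functional Kb' Kb) /c'; case: pselect.
move=> [phiH [phiK [cH cK mH mK red]]].
exists (Pmap (@is_sup_unique phiH)), (Pmap (@is_sup_unique phiK)).
split; [by exists phiH | by exists phiK |].
move=> G Gg p dp; have [b [Kb Qb bP]] := red p ((mdom_realizer_version f p).2 dp).
have [a [x [Gx /= aE /mval_choice_on lx]]] := Gg b ((mdom_choice_on b).2 Qb).
have [r Hr [y fy ry]] := bP _ lx.
exists r, y; split=> //; rewrite aE in Gx; exists (tuple2 p (val x)) => //.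
by exists p, (val x); split=> //; exists b.
Qed.

End ChoiceOn.

Lemma weihrauch_infinite_loop A A' Q Q' (X Y : repspace) (f : mfun X Y) :
  (forall B, Q B -> B !=set0) -> (forall B, Q' B -> B !=set0) ->
  (forall phiH phiK, monotone_word phiH -> monotone_word phiK ->
     choice_reduction A Q phiH phiK (realizer_version f) ->
     choice_reduction A' Q' (loopH phiH) (loopK phiH phiK)
       (loop (realizer_version f))) ->
  weihrauch f (choice_on A Q) -> weihrauch (infinite_loop f) (choice_on A' Q').
Proof.
move=> Qne Q'ne loop_red /(weihrauch_choice_on A f Qne).
move=> [phiH [phiK [cH cK mH mK red]]].
apply/(weihrauch_choice_on A' (infinite_loop f) Q'ne).
exists (loopH phiH), (loopK phiH phiK); split.
- exact: computable_loopH.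
- exact: computable_loopK.
- exact: monotone_monotonize.
- exact: monotone_loopK.
(* [baire_space] is represented by the identity, so passing to the realizer version of the loop
   changes nothing. *)
move=> p /mdom_realizer_version [_ /(_ p erefl) dp].
have [b [Kb Qb bP]] := loop_red _ _ mH mK red p dp.
exists b; split=> // a /bP [r Hr lr]; exists r => //.
by exists r => //; exists p.
Qed.

Theorem theorem24 (A : set baire) (X Y : repspace) (f : mfun X Y) :
  problem f ->
  (weihrauch f (closed_choice A) ->
     weihrauch (infinite_loop f) (closed_choice (sequences_in A))) /\
  (weihrauch f (unique_choice A) ->
     weihrauch (infinite_loop f) (unique_choice (sequences_in A))).
Proof.
move=> _; split.
  apply: (@weihrauch_infinite_loop A _ (fun B => B !=set0)
    (fun B => B !=set0)) => //.
  by move=> phiH phiK mH mK; exact: loop_reduction.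
have singleton_ne (B : set baire) : (exists a, B = [set a]) -> B !=set0.
  by move=> [a ->]; exists a.
apply: (@weihrauch_infinite_loop A _ (fun B => exists a, B = [set a])
  (fun B => exists a, B = [set a])) => //.
by move=> phiH phiK mH mK; exact: loop_unique_reduction.
Qed.
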